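(* Let $n\ge1$, let $f=\frac12\chi_{[-1,1]}$ be the uniform density on $[-1,1]$, let $\pi\in S_{n+1}$ and let $I_\pi$ be the root ideal of $\pi$. Let $w\in\widetilde{A}_n$ be the element whose alcove $w(\mathcal{A}_\circ)$ has address $k_w(i,j)=(i,j)_{I_\pi}$ for all $(i,j)\in\Phi^+$. Then \[ \mathbb{P}(f,\pi)=\frac{|[1,w]|}{2^n\,n!}, \] where $[1,w]$ is the set of all $v\in\widetilde{A}_n$ with $v\le w$ in the weak order on $\widetilde{A}_n$.
   Context: Random walk setup: $X_1,\dots,X_n$ are independent with density $f$, $Z_1=0$, $Z_i=X_1+\cdots+X_{i-1}$ ($2\le i\le n+1$); the ordinal pattern of distinct reals $(z_1,\dots,z_{n+1})$ is $\pi\in S_{n+1}$ with $\pi(i)=|\{j:z_i\ge z_j\}|$; $\mathbb{P}(f,\pi)$ is the probability that $(Z_1,\dots,Z_{n+1})$ has ordinal pattern $\pi$. Root system: let $\epsilon_1,\dots,\epsilon_{n+1}$ be the standard basis of $\mathbb{R}^{n+1}$ with the standard inner product, $V=\{\lambda:\ (\lambda,\epsilon_1+\cdots+\epsilon_{n+1})=0\}$, $\Phi^+=\{\epsilon_i-\epsilon_j: 1\le i<j\le n+1\}$, abbreviated as pairs $(i,j)$. For $(i,j)\in\Phi^+$ and $a\in\mathbb{Z}$ let $H_{ij}^a=\{\lambda\in V: (\lambda,\epsilon_i-\epsilon_j)=a\}$; the connected components of the complement in $V$ of all these hyperplanes are alcoves. Every alcove $\mathcal{A}$ has an address $k_{\mathcal{A}}:\Phi^+\to\mathbb{Z}$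 with $\mathcal{A}=\{\lambda: k_{\mathcal{A}}(i,j)<(\lambda,\epsilon_i-\epsilon_j)<k_{\mathcal{A}}(i,j)+1 \ \forall (i,j)\in\Phi^+\}$; the fundamental alcove $\mathcal{A}_\circ$ has address identically $0$. The affine Weyl group $\widetilde{A}_n$ is the group generated by the reflections in all hyperplanes $H_{ij}^a$; it acts simply transitively on alcoves, and is a Coxeter group with generators the reflections $s_1,\dots,s_n$ in $H^0_{i,i+1}$ and $s_{n+1}$ in $H^1_{1,n+1}$. For $w\in\widetilde{A}_n$, $k_w$ denotes the address of $w(\mathcal{A}_\circ)$. The length $\ell(w)$ is the minimal number of generators in an expression for $w$; the weak order is the transitive closure of the relation $w\to ws$ for generators $s$ with $\ell(ws)>\ell(w)$. Root poset: $(i',j')\le(i,j)$ iff $i\le i'<j'\le j$. For $\pi\in S_{n+1}$ and $c\in[n]$, the consecutive roots of $\pi$ are the pairs $(\min\{\pi(c),\pi(c+1)\},\max\{\pi(c),\pi(c+1)\})$; the root ideal $I_\pi$ is the set of $(i',j')\in\Phi^+$ that are $\le$ some consecutive root of $\pi$. For an ideal $I$ and $\alpha\in\Phi^+$, $\alpha_I=\min\{k: \alpha=\gamma_1+\cdots+\gamma_{k+1},\ \gamma_i\in I\}$ (sum as vectors). *)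

(* Defs.v *)
From HB Require Import structures.
From Stdlib Require Export Relation_Operators.
From mathcomp Require Export all_boot all_order all_algebra all_fingroup.
From mathcomp Require Export all_classical all_reals all_analysis.

Set Implicit Arguments.
Unset Strict Implicit.
Unset Printing Implicit Defensive.

Export Order.TTheory GRing.Theory Num.Theory.
Export numFieldNormedType.Exports.

Local Open Scope classical_set_scope.
Local Open Scope ring_scope.

(* Indices are 0-based: the mathematical index i in {1, ..., n+1} is the
   ordinal i-1 : 'I_n.+1, and a permutation in S_{n+1} is an element of
   'S_n.+1 acting on these ordinals. *)

(* The value is 0 if S is empty. *)
Definition nat_min (S : set nat) : nat :=
  xget 0%N [set m | S m /\ forall m', S m' -> (m <= m')%N].

Section RandomWalk.
Context {R : realType} {d : measure_display} {T : measurableType d}.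
Variable P : probability T R.

Definition mutually_independent (I : finType) (X : I -> {RV P >-> R}) : Prop :=
  forall (J : {set I}) (B : I -> set R), (forall i, measurable (B i)) ->
    P (\bigcap_(i in [set` J]) (X i @^-1` B i)) =
    (\prod_(i in J) P (X i @^-1` B i))%E.

Definition has_density (X : {RV P >-> R}) (f : R -> R) : Prop :=
  forall B : set R, measurable B ->
    distribution P X B = (\int[lebesgue_measure]_(x in B) (f x)%:E)%E.

Definition walk (n : nat) (X : 'I_n -> {RV P >-> R}) (w : T) (i : 'I_n.+1) : R :=
  \sum_(j < n | (j < i)%N) X j w.

End RandomWalk.

(* The successor accounts for the values of p being numbered from 0. *)
Definition has_ordinal_pattern (R : realType) (n : nat)
    (z : 'I_n.+1 -> R) (p : 'S_n.+1) : Prop :=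
  injective z /\ forall i, (p i).+1 = #|[set j : 'I_n.+1 | z j <= z i]%SET|.

Definition uniform_density (R : realType) (x : R) : R :=
  2^-1 * \1_(`[-1, 1] : set R) x.

Section RootSystem.
Variables (R : realType) (n : nat).

Definition dot (x y : 'rV[R]_n.+1) : R := \sum_i x 0 i * y 0 i.

(* A positive root e_i - e_j is represented by the pair (i, j) with i < j. *)
Definition root_vec (i j : 'I_n.+1) : 'rV[R]_n.+1 :=
  delta_mx 0 i - delta_mx 0 j.

Definition hypV : Type := {x : 'rV[R]_n.+1 | dot x (const_mx 1) == 0}.

Lemma dot_refl_subproof (x : hypV) (i j : 'I_n.+1) (c : R) :
  dot (val x - c *: root_vec i j) (const_mx 1) == 0.
Proof.
have root0 : dot (root_vec i j) (const_mx 1) = 0.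
  rewrite /dot; under eq_bigr do rewrite !mxE mulr1.
  rewrite sumrB (bigD1 i) //= [X in _ - X](bigD1 j) //= !eqxx.
  by rewrite !big1 ?addr0 ?subrr // => l /negbTE ->.
suff -> : dot (val x - c *: root_vec i j) (const_mx 1) =
    dot (val x) (const_mx 1) - c * dot (root_vec i j) (const_mx 1).
  by rewrite root0 mulr0 subr0; exact: valP x.
rewrite /dot mulr_sumr -sumrB; apply: eq_bigr => l _.
by rewrite !mxE !mulr1.
Qed.

(* Orthogonal reflection of V in {x | dot x (root_vec i j) = a}. *)
Definition reflection (i j : 'I_n.+1) (a : int) (x : hypV) : hypV :=
  exist _
    (val x - (2 * (dot (val x) (root_vec i j) - a%:~R) /
              dot (root_vec i j) (root_vec i j)) *: root_vec i j)
    (dot_refl_subproof x i j _).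

Inductive affine_weyl : (hypV -> hypV) -> Prop :=
| affine_weyl_refl (i j : 'I_n.+1) (a : int) :
    (i < j)%N -> affine_weyl (reflection i j a)
| affine_weyl_id : affine_weyl id
| affine_weyl_comp g h :
    affine_weyl g -> affine_weyl h -> affine_weyl (g \o h)
| affine_weyl_inv g h :
    affine_weyl g -> cancel g h -> cancel h g -> affine_weyl h.

(* k < n gives the reflection in H^0_{k,k+1}, and k = n the one in H^1_{0,n}. *)
Definition simple_refl (k : 'I_n.+1) : hypV -> hypV :=
  if (k < n)%N then reflection k (inord k.+1) 0 else reflection ord0 ord_max 1.

Definition word (s : seq 'I_n.+1) : hypV -> hypV :=
  foldr (fun k g => simple_refl k \o g) id s.

Definition coxeter_length (g : hypV -> hypV) : nat :=
  nat_min [set size s | s in [set s | word s = g]].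

Definition weak_step (v v' : hypV -> hypV) : Prop :=
  affine_weyl v /\
  exists k, v' = v \o simple_refl k /\ (coxeter_length v < coxeter_length v')%N.

Definition weak_le : (hypV -> hypV) -> (hypV -> hypV) -> Prop :=
  clos_refl_trans _ weak_step.

Definition weak_interval1 (w : hypV -> hypV) : set (hypV -> hypV) :=
  [set v | affine_weyl v /\ weak_le v w].

(* Only the values k i j with i < j matter. *)
Definition alcove_of_address (k : 'I_n.+1 -> 'I_n.+1 -> int) : set hypV :=
  [set x | forall i j : 'I_n.+1, (i < j)%N ->
     (k i j)%:~R < dot (val x) (root_vec i j) < (k i j + 1)%:~R].

Definition has_address (A : set hypV) (k : 'I_n.+1 -> 'I_n.+1 -> int) : Prop :=
  A = alcove_of_address k.

Definition fundamental_alcove : set hypV := alcove_of_address (fun _ _ => 0).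

End RootSystem.

Arguments fundamental_alcove : clear implicits.
Arguments uniform_density : clear implicits.

Definition pos_root (n : nat) (a : 'I_n.+1 * 'I_n.+1) : Prop := (a.1 < a.2)%N.

Definition root_le (n : nat) (a b : 'I_n.+1 * 'I_n.+1) : Prop :=
  (b.1 <= a.1)%N /\ (a.1 < a.2)%N /\ (a.2 <= b.2)%N.

Definition consecutive_root (n : nat) (p : 'S_n.+1) (c : 'I_n) :
    'I_n.+1 * 'I_n.+1 :=
  let u := p (widen_ord (leqnSn n) c) in
  let v := p (lift ord0 c) in
  if (u < v)%N then (u, v) else (v, u).

Definition root_ideal (n : nat) (p : 'S_n.+1) : set ('I_n.+1 * 'I_n.+1) :=
  [set a | pos_root a /\ exists c : 'I_n, root_le a (consecutive_root p c)].

Definition ideal_coef (R : realType) (n : nat)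
    (I : set ('I_n.+1 * 'I_n.+1)) (i j : 'I_n.+1) : nat :=
  nat_min [set k | exists g : 'I_k.+1 -> 'I_n.+1 * 'I_n.+1,
    (forall m, I (g m)) /\
    root_vec R i j = \sum_(m < k.+1) root_vec R (g m).1 (g m).2].

(* Main.v *)
Require Import Defs.
From mathcomp Require Import zify ring lra.
Local Open Scope classical_set_scope.
Local Open Scope ring_scope.
Set Implicit Arguments.
Unset Strict Implicit.
Unset Printing Implicit Defensive.

(* An element of the affine Weyl group is x |-> (x_(s i) + t i)_i for a
   permutation s and an integer vector t of sum zero; its window y_i = s i - (n+1) t i
   (residues numbered from 0) has address floor((y_j - y_i) / (n+1)), and a simple
   reflection on the right changes a single entry of the address by one.  Hence the
   length is the sum of the |k(i,j)|, and below a dominant w the weak order is the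
   entrywise order on nonnegative addresses.  For the w of the theorem, [1, w]
   consists of the increasing windows y with |y_(p(c+1)) - y_(p c)| <= n for all c.

   On the other side, the translated windows N_i = y_(p i) - y_(p 0) are the possible
   combinatorial types of the walk: the type records the integer parts of all
   differences Z_i - Z_j, and there are 2^n n! types, one for each choice of the
   signs of the X_i and of the order of the fractional parts of the Z_i.  Each type
   has probability at least 1/(2^n n!), by counting the cells of a fine cubical
   grid, hence exactly 1/(2^n n!).  The ordinal pattern is a function of the type. *)

Local Notation low := (widen_ord (leqnSn _)).
Local Notation up := (lift ord0).

(** * Windows, their addresses, and the right action of the simple reflections *)

Section Windows.
Variable n : nat.
Local Notation h := (n.+1%:Z).

Definition window (s : 'S_n.+1) (t : 'I_n.+1 -> int) (i : 'I_n.+1) : int :=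
  (s i)%:Z - h * t i.

Definition address (y : 'I_n.+1 -> int) (i j : 'I_n.+1) : int :=
  ((y j - y i) %/ h)%Z.

Lemma eq_divz (x q r : int) : x = q * h + r -> 0 <= r < h -> (x %/ h)%Z = q.
Proof. by move=> -> hr; rewrite divzMDl // divz_small ?addr0. Qed.

(** Residues lie between 0 and [n], so the floor division borrows one exactly when [s j < s i]. *)
Lemma address_window s t i j :
  address (window s t) i j = t i - t j - (s j < s i)%N%:Z.
Proof.
have := ltn_ord (s i); have := ltn_ord (s j) => hj hi.
apply: (@eq_divz _ _ ((s j)%:Z - (s i)%:Z + h * (s j < s i)%N%:Z)).
  by rewrite /window; ring.
by case: ltnP; rewrite ?mulr1 ?mulr0; lia.
Qed.

Lemma perm_neq (s : 'S_n.+1) i j : i != j -> (s i <> s j :> nat).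
Proof. by move=> /eqP ij /val_inj/perm_inj. Qed.

(** Distinct positions carry distinct residues, so the difference is never a multiple of [n+1] and
    the lower bound is strict as well. *)
Lemma window_sub s t i j : i != j ->
  h * address (window s t) i j < window s t j - window s t i <
  h * (address (window s t) i j + 1).
Proof.
rewrite address_window /window => ij.
have sij := @perm_neq s i j ij.
have := ltn_ord (s i); have := ltn_ord (s j) => hj hi.
set a := val (s i) in hi sij *; set b := val (s j) in hj sij *.
rewrite -[X in _ < X < _](_ : h * (t i - t j) + (b%:Z - a%:Z) = _); last by ring.
rewrite !mulrDr !mulrN; case: ltnP; rewrite ?mulr1 ?mulr0 ?oppr0; lia.
Qed.

Lemma address_opp s t i j : i != j ->
  address (window s t) j i = - 1 - address (window s t) i j.
Proof.
move=> ij; rewrite !address_window.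
have := @perm_neq s i j ij; lia.
Qed.

Lemma window_inj s t s' t' : window s t =1 window s' t' -> s = s' /\ t = t'.
Proof.
move=> e.
have et i : t i = t' i.
  have := e i; rewrite /window => ei.
  have := ltn_ord (s i); have := ltn_ord (s' i) => hi' hi.
  apply/eqP; rewrite eq_sym -subr_eq0 -[_ == _]negbK; apply/negP => tt0.
  have : h * `|t' i - t i| < h * 1.
    rewrite -[X in X * `|_|]ger0_norm // -normrM mulr1; lia.
  rewrite ltr_pM2l //; lia.
split; last exact/funext.
apply/permP => i; apply/val_inj => /=.
by have := e i; rewrite /window et => /addIr [].
Qed.

Lemma windowP (y : 'I_n.+1 -> int) :
  (forall i j, (y i = y j %[mod h])%Z -> i = j) ->
  exists s t, y = window s t.
Proof.
move=> yinj.
have hy i : (`|(y i %% h)%Z|%N < n.+1)%N.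
  have := ltz_pmod (y i) (isT : 0 < h); have := modz_ge0 (y i) (isT : h != 0); lia.
pose f i := Ordinal (hy i).
have finj : injective f.
  move=> i j [] e; apply: yinj.
  by rewrite -[LHS]gez0_abs ?modz_ge0// -[RHS]gez0_abs ?modz_ge0// e.
exists (perm finj), (fun i => - (y i %/ h)%Z); apply/funext => i.
rewrite /window permE /= gez0_abs ?modz_ge0 // [LHS](divz_eq (y i) h); ring.
Qed.

Lemma window_mod_inj s t i j :
  (window s t i = window s t j %[mod h])%Z -> i = j.
Proof.
rewrite /window => e; apply: (@perm_inj _ s); apply: val_inj => /=.
have := ltn_ord (s i); have := ltn_ord (s j) => hj hi.
move: e; rewrite ![_ - _]addrC -!mulrN ![h * _]mulrC !modzMDl !modz_small; lia.
Qed.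

Section Step.
Variables (s s' : 'S_n.+1) (t t' : 'I_n.+1 -> int).
Let y := window s t.
Let y' := window s' t'.
Let pos (k : 'I_n.+1) : 'I_n.+1 := (s^-1)%g k.

(** Passing to the cyclically next residue leaves remainder exactly 1, the least that [window_sub]
    allows; this makes the comparison in [window_const] sharp. *)
Lemma window_next k : (0 < n)%N ->
  y (pos (ordS k)) - y (pos k) = h * address y (pos k) (pos (ordS k)) + 1.
Proof.
move=> n0; rewrite /y address_window /window /pos !permKV.
case: k => k kn /=; rewrite -[(k.+1 %% n.+1)%N]/((k.+1 %% n.+1)%N).
have [e|] := eqVneq k n.
  by subst k; rewrite modnn; rewrite n0 /=; ring.
by move=> kn'; rewrite modn_small ?ltnNge ?leqnSn /=; lia.
Qed.

Lemma ordS_neq (k : 'I_n.+1) : (0 < n)%N -> ordS k != k.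
Proof.
move=> n0; rewrite -val_eqE /=; have := ltn_ord k; rewrite ltnS leq_eqVlt => /orP[/eqP ->|kn].
  by rewrite modnn; lia.
by rewrite modn_small //; lia.
Qed.

Lemma pos_neq k : (0 < n)%N -> pos k != pos (ordS k).
Proof. by move=> n0; rewrite (inj_eq perm_inj) eq_sym ordS_neq. Qed.

(* The differences of [y' - y] along the cyclic order of residues are
   nonnegative and sum to zero. *)
Lemma window_const : (0 < n)%N ->
  (forall k, address y (pos k) (pos (ordS k)) <=
             address y' (pos k) (pos (ordS k))) ->
  exists c, forall i, y' i = y i + c.
Proof.
move=> n0 le.
pose u k := y' (pos k) - y (pos k).
have d0 k : 0 <= u (ordS k) - u k.
  have := window_next k n0; rewrite /u.
  (* The difference in [y'] strictly exceeds [h] times its own address, so it is at least one more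
     than [h] times the address of [y], which is the difference in [y]. *)
  have /andP[lt1 _] := window_sub s' t' (pos_neq k n0).
  have : h * address y (pos k) (pos (ordS k)) <= h * address y' (pos k) (pos (ordS k)).
    by rewrite ler_wpM2l.
  move: lt1; rewrite -/y'; lia.
have s0 : \sum_k (u (ordS k) - u k) = 0.
  rewrite sumrB [X in _ - X](reindex_inj (@ordS_inj n.+1)) subrr //.
have ueq k : u (ordS k) = u k.
  have /psumr_eq0P : forall k, true -> 0 <= u (ordS k) - u k by move=> *.
  by move=> /(_ s0 k isT) /eqP; rewrite subr_eq0 => /eqP.
have uc (k : 'I_n.+1) : u k = u ord0.
  case: k => k; elim: k => [|k IH] kn; first by congr u; exact: val_inj.
  rewrite -(IH (ltnW kn)) -[RHS]ueq; congr u; apply: val_inj => /=.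
  by rewrite modn_small.
exists (u ord0) => i; have := uc (s i); rewrite /u /pos permK; lia.
Qed.

End Step.

Definition balanced (t : 'I_n.+1 -> int) := \sum_i t i = 0.

(** Balanced windows all have the entry sum 0 + 1 + ... + n, so summing the hypothesis gives
    [c * h = 0]. *)
Lemma window_balanced_inj s t s' t' c : balanced t -> balanced t' ->
  (forall i, window s' t' i = window s t i + c) -> s = s' /\ t = t'.
Proof.
move=> b b' e.
have c0 : c = 0.
  have : \sum_i window s' t' i = \sum_i window s t i + c * h.
    under eq_bigr do rewrite e.
    by rewrite big_split sumr_const card_ord -mulr_natr natz.
  rewrite !sumrB -!mulr_sumr b b' !mulr0 !subr0.
  rewrite (reindex_inj (@perm_inj _ (s'^-1)%g)).
  rewrite [X in _ = X + _](reindex_inj (@perm_inj _ (s^-1)%g)) /=.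
  under eq_bigr do rewrite permKV.
  under [X in _ = X + _]eq_bigr do rewrite permKV.
  nia.
by apply: window_inj => i; rewrite e c0 addr0.
Qed.

Lemma window_shift_balanced (s : 'S_n.+1) (t : 'I_n.+1 -> int) :
  exists s' t' c, balanced t' /\ forall i, window s' t' i = window s t i + c.
Proof.
(* Adding [c] to every entry adds [c * h] to their sum, which cancels the contribution [- h * c] of
   the translations. *)
pose c := \sum_i t i.
have [i j e|s' [t' e]] := @windowP (fun i => window s t i + c).
  apply: (@window_mod_inj s t).
  apply/eqP; rewrite eqz_mod_dvd.
  move/eqP: e; rewrite eqz_mod_dvd => /=.
  by congr (_ %| _)%Z; ring.
exists s', t', c; split=> [|i]; last by rewrite -e.
have : \sum_i window s' t' i = \sum_i window s t i + c * h.
  rewrite -e big_split sumr_const card_ord -mulr_natr natz //.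
rewrite !sumrB -!mulr_sumr.
rewrite (reindex_inj (@perm_inj _ (s'^-1)%g)).
rewrite [X in _ = X - _ + _](reindex_inj (@perm_inj _ (s^-1)%g)) /=.
under eq_bigr do rewrite permKV.
under [X in _ = X - _ + _]eq_bigr do rewrite permKV.
rewrite /balanced -/c [c * _]mulrC subrK => /eqP.
by rewrite subr_eq addrC -subr_eq subrr eq_sym mulf_eq0 => /orP[//|/eqP].
Qed.

(** On windows, the entry of residue [k] goes up by one and the entry of residue [ordS k] goes down
    by one. For [k = n] the residues wrap around, and [act_transl] records the carry. *)
Definition act_perm (s : 'S_n.+1) (k : 'I_n.+1) : 'S_n.+1 :=
  (s * tperm k (ordS k))%g.
Definition act_transl (s : 'S_n.+1) (t : 'I_n.+1 -> int) (k i : 'I_n.+1) : int :=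
  t i + (k == n :> nat)%:Z * ((s i == ordS k)%:Z - (s i == k)%:Z).

Lemma act_balanced s t k : balanced t -> balanced (act_transl s t k).
Proof.
rewrite /balanced /act_transl big_split /= => ->; rewrite add0r.
rewrite -mulr_sumr sumrB.
have S1 l : \sum_i (s i == l)%:Z = 1.
  rewrite (bigD1 ((s^-1)%g l)) //= permKV eqxx big1 ?addr0 // => i.
  by rewrite -(inj_eq (@perm_inj _ s)) permKV => /negbTE ->.
by rewrite !S1 subrr mulr0.
Qed.

(** An address changes only if the difference crosses a multiple of [n+1]. Since entries move by
    one, this happens only between the two moved entries, whose residues trade places. *)
Lemma address_act s t k i j : (0 < n)%N -> i != j ->
  address (window (act_perm s k) (act_transl s t k)) i j =
  address (window s t) i j
    - ((s i == k) && (s j == ordS k))%:Z + ((s j == k) && (s i == ordS k))%:Z.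
Proof.
move=> n0 ij; rewrite !address_window /act_perm /act_transl !permM.
have : s i != s j by rewrite (inj_eq perm_inj).
move: (s i) (s j) (t i) (t j) => a b ta tb {ij}.
have := ordS_neq k n0.
have : (val (ordS k) = if k == n :> nat then 0%N else k.+1).
  rewrite /=; case: eqVneq => [->|kn]; first by rewrite modnn.
  by rewrite modn_small // ltn_neqAle eqSS kn ltn_ord.
move: (ordS k) => k' ek' k'k ab.
have := ltn_ord a; have := ltn_ord b; have := ltn_ord k; move: ek' k'k ab.
have [|] := eqVneq (k : nat) n; rewrite ?mul1r ?mul0r => ekn.
all: case: (tpermP k k' a) => [->|->|/eqP ak /eqP ak'];
 case: (tpermP k k' b) => [->|->|/eqP bk /eqP bk'].
all: try move: ak ak'; try move: bk bk'; rewrite ?eqxx.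
all: rewrite -?(inj_eq val_inj) /=; lia.
Qed.

(** Each summand counts the parallel hyperplanes of one root that separate the alcove from the
    fundamental one. *)
Definition inversions (y : 'I_n.+1 -> int) : nat :=
  \sum_(ij : 'I_n.+1 * 'I_n.+1 | (ij.1 < ij.2)%N) `|address y ij.1 ij.2|%N.

(** The order of the two positions holding the residues [k] and [ordS k] decides whether the single
    affected root loses or gains one. The clause on [inversions] is additive because subtraction in
    [nat] truncates. *)
Lemma act_wall s t k : (0 < n)%N ->
  let y := window s t in
  let y' := window (act_perm s k) (act_transl s t k) in
  exists i j : 'I_n.+1, [/\ (i < j)%N,
    forall i' j' : 'I_n.+1, (i' < j')%N -> (i', j') != (i, j) ->
      address y' i' j' = address y i' j',
    (inversions y' + `|address y i j| = inversions y + `|address y' i j|)%N &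
    [/\ s i = k, s j = ordS k & address y' i j = address y i j - 1] \/
    [/\ s j = k, s i = ordS k & address y' i j = address y i j + 1]].
Proof.
move=> n0 y y'.
pose a := (s^-1)%g k; pose b := (s^-1)%g (ordS k).
have ab : a != b := pos_neq s k n0.
have sa : s a = k by rewrite permKV.
have sb : s b = ordS k by rewrite permKV.
have inj (x z : 'I_n.+1) : (s x == s z) = (x == z) := inj_eq perm_inj x z.
have addr i j : i != j -> address y' i j = address y i j
    - ((i == a) && (j == b))%:Z + ((j == a) && (i == b))%:Z.
  by move=> ij; rewrite address_act // -sb -sa !inj.
have inv (i j : 'I_n.+1) : (i < j)%N ->
    (forall i' j' : 'I_n.+1, (i' < j')%N -> (i', j') != (i, j) ->
      address y' i' j' = address y i' j') ->
    (inversions y' + `|address y i j| = inversions y + `|address y' i j|)%N.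
  move=> ij e; rewrite /inversions (bigD1 (i, j)) //= [in RHS](bigD1 (i, j)) //=.
  rewrite (eq_bigr (fun l => `|address y l.1 l.2|%N)); first by lia.
  by move=> [i' j'] /= /andP[lt ne]; rewrite e.
have ltneq (i j : 'I_n.+1) : (i < j)%N -> i != j.
  by rewrite -(inj_eq val_inj) /= ltn_neqAle => /andP[].
have [lt|lt|/val_inj e] := ltngtP a b; last by rewrite e eqxx in ab.
- have e (i' j' : 'I_n.+1) : (i' < j')%N -> (i', j') != (a, b) -> address y' i' j' = address y i' j'.
    move=> lt' ne; rewrite addr ?ltneq //; rewrite xpair_eqE in ne.
    rewrite (negbTE ne) subr0.
    case: (eqVneq j' a) lt' => [-> |_] lt'; last by rewrite addr0.
    by case: (eqVneq i' b) lt' => [-> |_]; rewrite ?addr0 //=; lia.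
  exists a, b; split=> //; first exact: inv.
  by left; split=> //; rewrite addr // !eqxx /= [b == a]eq_sym (negbTE ab) addr0.
- have e (i' j' : 'I_n.+1) : (i' < j')%N -> (i', j') != (b, a) -> address y' i' j' = address y i' j'.
    move=> lt' ne; rewrite addr ?ltneq //; rewrite xpair_eqE andbC in ne.
    rewrite (negbTE ne) addr0.
    case: (eqVneq i' a) lt' => [-> |_] lt'; last by rewrite subr0.
    by case: (eqVneq j' b) lt' => [-> |_]; rewrite ?subr0 //=; lia.
  exists b, a; split=> //; first exact: inv.
  right; split=> //; rewrite addr 1?eq_sym // !eqxx /=.
  by rewrite (negbTE ab) ?andbF subr0.
Qed.

Lemma wall_towards s t s' t' : (0 < n)%N -> balanced t -> balanced t' ->
  ~ (s = s' /\ t = t') ->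
  let y := window s t in
  let y' := window s' t' in
  exists k, let z := window (act_perm s k) (act_transl s t k) in
  exists i j : 'I_n.+1, [/\ (i < j)%N,
    forall i' j' : 'I_n.+1, (i' < j')%N -> (i', j') != (i, j) ->
      address z i' j' = address y i' j',
    (inversions z + `|address y i j| = inversions y + `|address z i j|)%N &
    (address z i j = address y i j - 1 /\ address y' i j <= address z i j) \/
    (address z i j = address y i j + 1 /\ address z i j <= address y' i j)].
Proof.
move=> n0 b b' ne y y'.
(* Otherwise no address of [y] between cyclically consecutive residues exceeds that of [y']; then
   [window_const] makes the windows differ by a constant, and balance makes them equal. *)
have [k lt] : exists k, address y' ((s^-1)%g k) ((s^-1)%g (ordS k)) <
    address y ((s^-1)%g k) ((s^-1)%g (ordS k)).
  apply: contrapT => all; apply: ne.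
  have [|c e] := @window_const s s' t t' n0; last exact: window_balanced_inj e.
  by move=> k; rewrite leNgt; apply/negP => lt; apply: all; exists k.
exists k => z; have [i [j [ij e inv st]]] := act_wall s t k n0.
exists i, j; split=> //.
have ne_ij : i != j by rewrite -(inj_eq val_inj) /= ltn_neqAle in ij *; case/andP: ij.
case: st => -[si sj ez]; [left|right]; split=> //.
  by move: lt; rewrite -sj -si !permK; rewrite -/z -/y in ez; lia.
move: lt; rewrite -sj -si !permK.
rewrite (@address_opp s t i j) // (@address_opp s' t' i j) //.
rewrite -/y -/y' => lt; rewrite -/z -/y in ez; lia.
Qed.

End Windows.

(** * The affine Weyl group in coordinates, its length and its weak order *)

Section AffineWeyl.
Variables (R : realType) (n : nat).
Local Notation V := (hypV R n).
Local Notation h := (n.+1%:Z).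

Lemma dot_root (x : 'rV[R]_n.+1) i j : dot x (root_vec R i j) = x 0 i - x 0 j.
Proof.
rewrite /dot /root_vec; under eq_bigr do rewrite !mxE mulrBr eqxx /=.
have S1 (l : 'I_n.+1) : \sum_i x 0 i * (i == l)%:R = x 0 l.
  by rewrite (bigD1 l) //= eqxx mulr1 big1 ?addr0 // => m /negbTE ->; rewrite mulr0.
by rewrite sumrB !S1.
Qed.

Definition represents (v : V -> V) (s : 'S_n.+1) (t : 'I_n.+1 -> int) :=
  forall x i, val (v x) 0 i = val x 0 (s i) + (t i)%:~R.

Lemma reflectionE i j a (x : V) l : i != j ->
  val (reflection i j a x) 0 l =
  val x 0 (tperm i j l) + (a * ((l == i)%:Z - (l == j)%:Z))%:~R.
Proof.
move=> ij; rewrite /= !mxE !dot_root !mxE !eqxx /= [j == i]eq_sym (negbTE ij).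
set b := val x 0 i - val x 0 j - a%:~R.
have -> : 2 * b / (1 - 0 - (0 - 1)) = b by field.
rewrite /b {b} rmorphM rmorphB /=.
case: tpermP => [->|->|/eqP/negbTE -> /eqP/negbTE ->].
- by rewrite eqxx (negbTE ij) /=; ring.
- by rewrite eqxx eq_sym (negbTE ij) /=; ring.
- by rewrite /=; ring.
Qed.

Lemma represents_id : represents id 1%g (fun=> 0).
Proof. by move=> x i; rewrite perm1 addr0. Qed.

Lemma represents_comp v s t v' s' t' : represents v s t -> represents v' s' t' ->
  represents (v \o v') (s * s')%g (fun i => t' (s i) + t i).
Proof. by move=> rv rv' x i; rewrite /= rv rv' permM rmorphD addrA. Qed.

Lemma represents_inj v v' s t : represents v s t -> represents v' s t -> v = v'.
Proof.
move=> rv rv'; apply/funext => x; apply: val_inj; apply/rowP => i.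
by rewrite rv rv'.
Qed.

(** The mean [c] puts the point in the hyperplane [V]. If [v] is represented by [s] and [t], the
    image of this point has coordinates [c] minus the window entries over [n+1], so one point
    reveals the whole window. *)
Lemma center_proof (c := (\sum_(i < n.+1) i%:R / n.+1%:R) / n.+1%:R : R) :
  dot (\row_(i < n.+1) (c - i%:R / n.+1%:R)) (const_mx 1) == 0.
Proof.
rewrite /dot; under eq_bigr do rewrite !mxE mulr1.
have h0 : n.+1%:R != 0 :> R by rewrite pnatr_eq0.
by rewrite sumrB sumr_const card_ord -[c *+ _]mulr_natr /c divfK ?subrr.
Qed.
Definition center : V :=
  exist (fun x => is_true (dot x (const_mx 1) == 0)) _ center_proof.

Lemma center_window v s t i j : represents v s t ->
  val (v center) 0 i - val (v center) 0 j =
  (window s t j - window s t i)%:~R / n.+1%:R.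
Proof.
move=> rv; rewrite !rv !mxE /window !rmorphB !rmorphM /=.
have h0 : n.+1%:R != 0 :> R by rewrite pnatr_eq0.
have -> : h%:~R = n.+1%:R :> R by [].
have -> : (s i)%:Z%:~R = (s i)%:R :> R by [].
have -> : (s j)%:Z%:~R = (s j)%:R :> R by [].
by field.
Qed.

Lemma center_in_fundamental : fundamental_alcove R n center.
Proof.
move=> i j ij; rewrite dot_root (center_window i j represents_id).
rewrite /window !perm1 !mulr0 !subr0 rmorphB /=.
have h0 : 0 < n.+1%:R :> R by rewrite ltr0n.
rewrite -pmulrn ltr_pdivlMr // mul0r ltr_pdivrMr //.
have -> : (i : nat)%:Z%:~R = (i : nat)%:R :> R by [].
rewrite subr_gt0 ltr_nat ij mul1r /= ltrBlDr -natrD ltr_nat.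
by have := ltn_ord j; lia.
Qed.

Lemma represents_window_inj v s t s' t' :
  represents v s t -> represents v s' t' -> s = s' /\ t = t'.
Proof.
move=> rv rv'; apply: window_inj => i.
have h0 : n.+1%:R != 0 :> R by rewrite pnatr_eq0.
apply: (@intr_inj R); rewrite /window !rmorphB !rmorphM /=.
have := rv center i; rewrite rv' !mxE => /(congr1 ( *%R n.+1%:R)).
rewrite !mulrDr !mulrN !(mulrCA n.+1%:R _ (n.+1%:R)^-1) !divff // !mulr1.
by rewrite -!pmulrn; lra.
Qed.

(** Both addresses bracket the same coordinate difference of [v center] strictly between consecutive
    integers, so they agree. *)
Lemma address_of_alcove v s t (k : 'I_n.+1 -> 'I_n.+1 -> int) :
  represents v s t -> has_address (v @` fundamental_alcove R n) k ->
  forall i j : 'I_n.+1, (i < j)%N -> address (window s t) i j = k i j.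
Proof.
move=> rv e i j ij.
have : (v @` fundamental_alcove R n) (v center).
  by exists center => //; exact: center_in_fundamental.
rewrite e => /(_ i j ij); rewrite dot_root (center_window i j rv).
have h0 : 0 < n.+1%:R :> R by rewrite ltr0n.
have neq : i != j by rewrite -(inj_eq val_inj) /= ltn_eqF.
rewrite ltr_pdivlMr // ltr_pdivrMr // !(pmulrn _ n.+1) -!intrM !ltr_int.
have := window_sub s t neq; move: (address _ i j) (_ - _) => a d.
move=> /andP[l1 l2] /andP[l3 l4].
have : h * a < h * (k i j + 1) by lia.
have : h * k i j < h * (a + 1) by lia.
by rewrite !ltr_pM2l //; lia.
Qed.

Lemma affine_weyl_represents (v : V -> V) : affine_weyl v ->
  exists s t, balanced t /\ represents v s t.
Proof.
elim=> [i j a ij||g g' _ [s [t [b r]]] _ [s' [t' [b' r']]]|g g' _ [s [t [b r]]] K K'].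
- have neq : i != j by rewrite -(inj_eq val_inj) /= ltn_eqF.
  exists (tperm i j), (fun l => a * ((l == i)%:Z - (l == j)%:Z)).
  split=> [|x l]; last exact: reflectionE.
  have S1 (l : 'I_n.+1) : \sum_i (i == l)%:Z = 1.
    by rewrite (bigD1 l) //= eqxx big1 ?addr0 // => m /negbTE ->.
  by rewrite /balanced -mulr_sumr sumrB !S1 subrr mulr0.
- exists 1%g, (fun=> 0); split; last exact: represents_id.
  by rewrite /balanced big1.
- exists (s * s')%g, (fun i => t' (s i) + t i); split; last exact: represents_comp.
  rewrite /balanced (reindex_inj (@perm_inj _ s)) in b'.
  by rewrite /balanced big_split /= b' b.
- exists (s^-1)%g, (fun i => - t ((s^-1)%g i)); split.
    rewrite /balanced (reindex_inj (@perm_inj _ (s^-1)%g)) in b.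
    by rewrite /balanced sumrN b oppr0.
  move=> x i; have := r (g' x) ((s^-1)%g i).
  by rewrite K' permKV => ->; rewrite rmorphN /= addrK.
Qed.

Hypothesis n_gt0 : (0 < n)%N.

(** The cyclic successor merges the two kinds of generators: for [k = n] it is 0, and only then is
    there a translation part. *)
Lemma represents_simple (k : 'I_n.+1) : represents (@simple_refl R n k)
  (tperm k (ordS k))
  (fun i => (k == n :> nat)%:Z * ((i == ordS k)%:Z - (i == k)%:Z)).
Proof.
move=> x l; rewrite /simple_refl.
case: ifPn => kn.
  have e : inord k.+1 = ordS k.
    by apply: val_inj; rewrite /= inordK ?ltnS // modn_small.
  rewrite e reflectionE; last by rewrite eq_sym ordS_neq.
  by rewrite ltn_eqF // !mul0r.
have e : k = ord_max by apply: val_inj; have := ltn_ord k => /=; lia.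
have e0 : ordS k = ord0 by apply: val_inj; rewrite e /= modnn.
rewrite e0 e reflectionE ?eqxx; last by rewrite -(inj_eq val_inj) /=; lia.
by rewrite tpermC.
Qed.

Lemma represents_act v s t k : represents v s t ->
  represents (v \o @simple_refl R n k) (act_perm s k) (act_transl s t k).
Proof.
move=> rv x i; rewrite (represents_comp rv (represents_simple k)).
by rewrite /act_perm /act_transl [t i + _]addrC.
Qed.

Lemma word_rcons l k : @word R n (rcons l k) = @word R n l \o @simple_refl R n k.
Proof. by elim: l => [|k' l /= ->]. Qed.

Lemma word_affine l : affine_weyl (@word R n l : V -> V).
Proof.
elim: l => [|k l IH] /=; first exact: affine_weyl_id.
apply: affine_weyl_comp => //; rewrite /simple_refl; case: ifP => kn.
  by apply: affine_weyl_refl; rewrite inordK ?ltnS.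
exact: affine_weyl_refl.
Qed.

(** This bounds the length from below: each further letter changes one address by one, so it adds at
    most one inversion. *)
Lemma word_represents l : exists s t,
  [/\ balanced t, represents (@word R n l) s t & (inversions (window s t) <= size l)%N].
Proof.
elim/last_ind: l => [|l k [s [t [b r le]]]].
  exists 1%g, (fun=> 0); split; [by rewrite /balanced big1 | exact: represents_id | ].
  rewrite /inversions big1 // => -[i j] /= ij; rewrite address_window !perm1; lia.
exists (act_perm s k), (act_transl s t k); split; first exact: act_balanced.
  by rewrite word_rcons; exact: represents_act.
have [i [j [_ _ inv st]]] := act_wall s t k n_gt0.
rewrite size_rcons; case: st => -[_ _ e]; rewrite e in inv; lia.
Qed.

Lemma act_permK s (k : 'I_n.+1) : act_perm (act_perm s k) k = s.
Proof. by rewrite /act_perm -mulgA tperm2 mulg1. Qed.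

Lemma act_translK s t (k : 'I_n.+1) :
  act_transl (act_perm s k) (act_transl s t k) k = t.
Proof.
apply/funext => i; rewrite /act_transl /act_perm permM -addrA -mulrDr.
rewrite -[RHS]addr0; congr (_ + _).
have /negbTE ne := ordS_neq k n_gt0.
by case: tpermP => [->|->|/eqP/negbTE -> /eqP/negbTE ->];
  rewrite ?eqxx ?[k == _]eq_sym ?ne /=; ring.
Qed.

(** This bounds the length from above: walls crossed towards the identity window remove one
    inversion each, and since the action of [k] is an involution the crossed letters spell a
    word. *)
Lemma represents_word s t : balanced t -> exists l,
  represents (@word R n l) s t /\ size l = inversions (window s t).
Proof.
have [m] := ubnP (inversions (window s t)).
elim: m s t => // m IH s t lem b.
have [[-> ->]|ne] := pselect (s = 1%g /\ t = fun=> 0).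
  exists [::]; split; first exact: represents_id.
  rewrite /inversions big1 // => -[i j] /= ij; rewrite address_window !perm1; lia.
have b0 : balanced (fun=> 0 : int) by move=> N; rewrite /balanced big1.
have [k [i [j [ij _ inv st]]]] := wall_towards n_gt0 b (b0 n) ne.
have e0 : address (window 1%g (fun=> 0)) i j = 0 by rewrite address_window !perm1; lia.
(* The target address is 0, so moving towards it lowers the absolute value. *)
rewrite e0 in st.
have lt : (inversions (window (act_perm s k) (act_transl s t k))).+1 =
  inversions (window s t) by case: st => -[e le]; lia.
have [||l [rl sl]] := IH (act_perm s k) (act_transl s t k); first lia.
  exact: act_balanced.
exists (rcons l k); rewrite size_rcons sl lt word_rcons; split=> //.
by have := represents_act k rl; rewrite act_permK act_translK.
Qed.

Lemma represents_affine v s t : balanced t -> represents v s t -> affine_weyl v.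
Proof.
move=> b r; have [l [rl _]] := represents_word s b.
by rewrite (represents_inj r rl); exact: word_affine.
Qed.

Lemma coxeter_lengthE v s t : balanced t -> represents v s t ->
  coxeter_length v = inversions (window s t).
Proof.
move=> b r; rewrite /coxeter_length /nat_min; apply: xget_unique.
  split; last first.
    move=> _ [l /= lv <-]; have [s' [t' [b' r' le]]] := word_represents l.
    by rewrite lv in r'; have [-> ->] := represents_window_inj r r'.
  have [l [rl <-]] := represents_word s b.
  by exists l => //=; exact: represents_inj rl r.
move=> m [[l /= lv <-] min]; apply/eqP; rewrite eqn_leq.
have [s' [t' [b' r' le]]] := word_represents l.
rewrite lv in r'; have [-> ->] := represents_window_inj r r'.
rewrite le andbT; have [l' [rl' <-]] := represents_word s' b'.
by apply: min; exists l' => //=; exact: represents_inj rl' r'.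
Qed.

(** With [y = y'] this says that the alcove is dominant. *)
Definition between0 (y y' : 'I_n.+1 -> int) := forall i j : 'I_n.+1, (i < j)%N ->
  0 <= address y i j <= address y' i j.

Lemma weak_le_between0 v v' s t s' t' : weak_le v v' -> affine_weyl v ->
  represents v s t -> represents v' s' t' ->
  between0 (window s' t') (window s' t') -> between0 (window s t) (window s' t').
Proof.
move=> le av rv rv' pos.
(* The claim is generalized over all windows, and membership of [v'] is carried along so that
   transitivity can be chained. *)
suff [_] : affine_weyl v' /\ forall s t s' t',
    represents v s t -> represents v' s' t' ->
    between0 (window s' t') (window s' t') -> between0 (window s t) (window s' t').
  exact.
move: le av {rv rv' pos s t s' t'}; elim=> {v v'}.
- move=> v _ [_ [k [-> lt]]] av; split.
    by apply: affine_weyl_comp => //; have := word_affine [:: k].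
  move=> s t s' t' rv rv' pos i j ij.
  have [s1 [t1 [b r]]] := affine_weyl_represents av.
  have [? ?] := represents_window_inj rv r; subst s1 t1.
  have ra := represents_act k rv.
  have [? ?] := represents_window_inj rv' ra; subst s' t'.
  rewrite (coxeter_lengthE b rv) (coxeter_lengthE (act_balanced s k b) ra) in lt.
  have [a [c [ac e inv st]]] := act_wall s t k n_gt0.
  have p1 := pos _ _ ij; have p2 := pos _ _ ac.
  have [[e1 e2]|ne] := eqVneq (i, j) (a, c); last by rewrite -e //; lia.
  rewrite e1 e2 in p1 *.
  (* A decrease that adds an inversion would start at an address at most 0 and end below 0, against
     dominance; so the address increases, from a nonnegative value. *)
  by case: st => -[_ _ ez]; rewrite ez in inv p1 *; lia.
- move=> v av; split=> // s t s' t' r r' pos.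
  by have [<- <-] := represents_window_inj r' r.
- move=> v v1 v2 _ IH1 _ IH2 av.
  have [av1 H1] := IH1 av; have [av2 H2] := IH2 av1; split=> //.
  move=> s t s' t' r r' pos.
  have [s1 [t1 [b1 r1]]] := affine_weyl_represents av1.
  (* The upper half comes first: it makes the intermediate window dominant, as the lower half
     requires. *)
  have le2 := H2 _ _ _ _ r1 r' pos.
  have le1 : between0 (window s t) (window s1 t1).
    by apply: H1 r r1 _ => i j ij; have /andP[-> _] := le2 i j ij; rewrite lexx.
  move=> i j ij; have /andP[-> le] := le1 i j ij.
  by have /andP[_] := le2 i j ij; exact: le_trans.
Qed.

(** Induction on the entrywise distance of the two addresses, crossing one wall towards [v'] at a
    time. *)
Lemma between0_weak_le v v' s t s' t' : balanced t -> balanced t' ->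
  represents v s t -> represents v' s' t' ->
  between0 (window s t) (window s' t') -> weak_le v v'.
Proof.
move=> b b' + rv'.
have [m] := ubnP (\sum_(ij : 'I_n.+1 * 'I_n.+1 | (ij.1 < ij.2)%N)
  `|address (window s' t') ij.1 ij.2 - address (window s t) ij.1 ij.2|%N).
elim: m v s t b => // m IH v s t b lem rv bet.
have [[es et]|ne] := pselect (s = s' /\ t = t').
  by subst; rewrite (represents_inj rv rv'); exact: rt_refl.
have [k [i [j [ij e inv st]]]] := wall_towards n_gt0 b b' ne.
have bij := bet _ _ ij.
(* No entry exceeds its target, so the step cannot go down; from a nonnegative entry, going up
   increases the length. *)
have {}st : address (window (act_perm s k) (act_transl s t k)) i j =
    address (window s t) i j + 1 /\
    address (window (act_perm s k) (act_transl s t k)) i j <=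
    address (window s' t') i j by case: st => //; lia.
have ra := represents_act k rv; have ba := act_balanced s k b.
apply: (@rt_trans _ _ _ (v \o @simple_refl R n k)).
  apply: rt_step; split; first exact: represents_affine rv.
  exists k; split=> //; rewrite (coxeter_lengthE b rv) (coxeter_lengthE ba ra).
  case: st => st _; rewrite st in inv; lia.
apply: IH ra _ => //.
  rewrite (bigD1 (i, j)) //= in lem; rewrite (bigD1 (i, j)) //=.
  rewrite (eq_bigr (fun l => `|address (window s' t') l.1 l.2
     - address (window s t) l.1 l.2|%N)); first by move: (bigop.body _ _ _) lem => S; lia.
  by move=> [i' j'] /= /andP[lt' ne']; rewrite e.
move=> i' j' ij'; have b1 := bet _ _ ij'.
have [[e1 e2]|ne'] := eqVneq (i', j') (i, j); last by rewrite e.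
by rewrite e1 e2; lia.
Qed.

Lemma weak_interval1P w s' t' v : balanced t' -> represents w s' t' ->
  between0 (window s' t') (window s' t') ->
  weak_interval1 w v <->
  exists s t, [/\ balanced t, represents v s t &
    between0 (window s t) (window s' t')].
Proof.
move=> b' r' pos; split.
  move=> [av le]; have [s [t [b r]]] := affine_weyl_represents av.
  by exists s, t; split=> //; exact: weak_le_between0 le av r r' pos.
move=> [s [t [b r bet]]]; split; first exact: represents_affine r.
exact: between0_weak_le r r' bet.
Qed.


End AffineWeyl.

(** * Minima of sets of naturals, and sums indexed by ordinals *)

Lemma nat_min_spec (S : set nat) : S !=set0 ->
  S (nat_min S) /\ forall m, S m -> (nat_min S <= m)%N.
Proof.
move=> [m Sm].
have ex : exists m, `[< S m >] by exists m; apply/asboolP.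
suff : [set m | S m /\ forall m', S m' -> (m <= m')%N] (nat_min S) by [].
rewrite /nat_min; apply: (@xgetI _ _ _ (ex_minn ex)).
case: ex_minnP => k /asboolP Sk min; split=> // m' Sm'.
by apply: min; apply/asboolP.
Qed.

Lemma const_ord (T : Type) n (f : 'I_n.+1 -> T) :
  (forall c : 'I_n, f (up c) = f (low c)) -> forall i, f i = f ord0.
Proof.
move=> step [i]; elim: i => [|i IH] ltin; first by congr f; exact: val_inj.
have lti : (i < n)%N by [].
rewrite -(IH (ltnW ltin)).
rewrite (_ : Ordinal ltin = up (Ordinal lti)); last exact: val_inj.
by rewrite step; congr f; exact: val_inj.
Qed.

Lemma sum_below_up (V : nmodType) n (F : 'I_n -> V) (c : 'I_n) :
  \sum_(j < n | (j < lift ord0 c)%N) F j =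
  \sum_(j < n | (j < widen_ord (leqnSn n) c)%N) F j + F c.
Proof.
rewrite (bigD1 c) /=; last by rewrite /bump; lia.
rewrite addrC; congr (_ + _); apply: eq_bigl => i.
by rewrite -(inj_eq val_inj) /bump /=; lia.
Qed.

Lemma dot_sum (R : realType) n (I : finType) (x : 'rV[R]_n.+1) (F : I -> 'rV[R]_n.+1) :
  dot x (\sum_i F i) = \sum_i dot x (F i).
Proof.
rewrite /dot exchange_big; apply: eq_bigr => j _.
by rewrite summxE mulr_sumr.
Qed.

(** * The root ideal and step bounds along [p] *)

Section Ideal.
Variables (R : realType) (n : nat) (p : 'S_n.+1).
Local Notation h := (n.+1%:Z).

(* The path p 0, p 1, ..., p n visits both sides of the gap between i and
   i + 1, so one of its steps crosses that gap. *)
Lemma simple_root_in_ideal (i : 'I_n) : root_ideal p (low i, up i).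
Proof.
split; first by rewrite /pos_root /= /bump.
apply: contrapT => none.
have step (c : 'I_n) : (p (up c) <= i)%N = (p (low c) <= i)%N.
  apply: contrapT => ne; apply: none; exists c; move: ne.
  rewrite /consecutive_root /root_le; case: (ltnP (p (low c)) (p (up c))) => h1;
    case: (leqP (p (up c)) i) => h2; case: (leqP (p (low c)) i) => h3 ne;
    by [case: ne | rewrite /= /bump /=; lia].
have cst := @const_ord bool n (fun j => (p j <= i)%N) step.
have := cst ((p^-1)%g ord0); have := cst ((p^-1)%g ord_max).
by rewrite !permKV /= => <-; have := ltn_ord i; lia.
Qed.

Variables (s : 'S_n.+1) (t : 'I_n.+1 -> int).
Let y := window s t.
Hypothesis pos : forall i j : 'I_n.+1, (i < j)%N -> 0 <= address y i j.

Lemma window_lt (i j : 'I_n.+1) : (i < j)%N -> y i < y j.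
Proof.
move=> ij; have neq : i != j by rewrite -(inj_eq val_inj) /= ltn_eqF.
have /andP[lt _] := window_sub s t neq.
have := pos ij; rewrite -(ler_pM2l (isT : 0 < h)) mulr0 -/y in lt *; lia.
Qed.

Lemma window_le (i j : 'I_n.+1) : (i <= j)%N -> y i <= y j.
Proof.
rewrite leq_eqVlt => /orP[/eqP/val_inj -> //|/window_lt/ltW //].
Qed.

(** The root splits into [j - i] simple roots, all of them in the ideal; the coefficient is one less
    than the number of summands. *)
Lemma ideal_coef_ex (i j : 'I_n.+1) : (i < j)%N ->
  [set k | exists g : 'I_k.+1 -> 'I_n.+1 * 'I_n.+1,
    (forall m, root_ideal p (g m)) /\
    root_vec R i j = \sum_(m < k.+1) root_vec R (g m).1 (g m).2] !=set0.
Proof.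
move=> ij; exists (j - i).-1.
have ek : (j - i).-1.+1 = (j - i)%N by lia.
pose e m : 'rV[R]_n.+1 := delta_mx 0 (inord (i + m) : 'I_n.+1).
exists (fun m => (inord (i + m), inord (i + m.+1))); split.
  move=> m; have mn : (i + m < n)%N by have := ltn_ord m; have := ltn_ord j; lia.
  have := simple_root_in_ideal (Ordinal mn).
  congr (root_ideal p (_, _)); apply: val_inj; rewrite /= ?/bump inordK; lia.
under eq_bigr do rewrite /root_vec /= -/(e _) -/(e (_.+1)).
rewrite -(big_mkord xpredT (fun m => e m - e m.+1)).
rewrite (eq_bigr (fun m => - (e m.+1 - e m))); last by move=> *; rewrite opprB.
rewrite sumrN telescope_sumr // opprB ek /e addn0 subnKC ?(ltnW ij) //.
by rewrite !inord_val.
Qed.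

(** Forward, consecutive roots have coefficient 0. Backward, each of the [k+1] roots of a shortest
    decomposition lies below a consecutive root, so by monotonicity of [y] it contributes less than
    [h]. *)
Lemma ideal_coef_boundP :
  (forall i j : 'I_n.+1, (i < j)%N ->
     address y i j <= (ideal_coef R (root_ideal p) i j)%:Z) <->
  (forall c : 'I_n, `|y (p (up c)) - y (p (low c))| < h).
Proof.
split=> [le c|st i j ij].
  have ne : p (low c) != p (up c).
    by rewrite (inj_eq perm_inj) -(inj_eq val_inj) /= /bump; lia.
  pose a := consecutive_root p c.
  have a12 : (a.1 < a.2)%N.
    rewrite /a /consecutive_root; case: (ltnP (p (low c)) (p (up c))) => h1 /=; first by [].
    by move: ne h1; rewrite -(inj_eq val_inj) /=; lia.
  have Ia : root_ideal p a by split=> //; exists c; split.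
  have c0 : ideal_coef R (root_ideal p) a.1 a.2 = 0%N.
    apply/eqP; rewrite -leqn0; apply: (nat_min_spec (ideal_coef_ex a12)).2.
    by exists (fun=> a); rewrite big_ord1.
  have := le _ _ a12; rewrite c0 => le0.
  have ne12 : a.1 != a.2 by rewrite -(inj_eq val_inj) /= ltn_eqF.
  have /andP[_ lt] := window_sub s t ne12.
  have lt1 := window_lt a12.
  have lt2 : y a.2 - y a.1 < h.
    apply: lt_le_trans lt _; rewrite -[leRHS]mulr1 ler_pM2l // -/y; lia.
  move: lt1 lt2; rewrite /a /consecutive_root; case: ifP => _ /=; lia.
have [[g [Ig e]] _] := nat_min_spec (ideal_coef_ex ij).
rewrite -/(ideal_coef R (root_ideal p) i j) in g Ig e *.
set k := ideal_coef _ _ _ _ in g Ig e *.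
have {}e : y j - y i = \sum_(m < k.+1) (y (g m).2 - y (g m).1).
  (* Pairing the vector identity with the window turns it into an identity between window
     differences, with signs reversed. *)
  pose Y := \row_i (y i)%:~R : 'rV[R]_n.+1.
  have := congr1 (dot Y) e; rewrite dot_sum dot_root !mxE.
  under eq_bigr do rewrite dot_root !mxE -rmorphB.
  rewrite -rmorphB -rmorph_sum => /intr_inj e'.
  rewrite -opprB e' -sumrN; apply: eq_bigr => m _; exact: opprB.
have ne : i != j by rewrite -(inj_eq val_inj) /= ltn_eqF.
have /andP[lt _] := window_sub s t ne.
have le : y j - y i <= \sum_(m < k.+1) h.
  rewrite e; apply: ler_sum => m _.
  have [_ [c [g1 [_ g2]]]] := Ig m.
  have := window_le g1; have := window_le g2; have := st c.
  rewrite /consecutive_root; case: ifP => _ /=; lia.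
have : h * address y i j < h * (k%:Z + 1).
  apply: lt_le_trans lt _; apply: le_trans le _.
  by rewrite sumr_const card_ord -mulr_natr natz ler_pM2l //; lia.
rewrite ltr_pM2l //; lia.
Qed.

End Ideal.

(** * Combinatorial types of walks and their number *)

Section Types.
Variable n : nat.
Local Notation h := (n.+1%:Z).

(* A normalized window with steps smaller than [n+1] in absolute value is given
   by the signs of its steps and by its residues modulo [n+1]. *)
Definition walk_type : finType := ({ffun 'I_n -> bool} * 'S_n.+1)%type.

(** The increments are solved from [address_window] so that step [c] has address 0 (an ascent) if
    [u.1 c] holds and -1 (a descent) otherwise. *)
Definition type_transl (u : walk_type) (i : 'I_n.+1) : int :=
  \sum_(c < n | (c < i)%N) ((~~ u.1 c)%:Z - (u.2 (up c) < u.2 (low c))%N%:Z).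

Definition type_window (u : walk_type) := window u.2 (type_transl u).

(** Fixing [ord0] normalizes the window to start at 0, like the walk. *)
Definition walk_types : {set walk_type} := [set u : walk_type | u.2 ord0 == ord0]%SET.

Lemma card_walk_types : #|walk_types| = (2 ^ n * n`!)%N.
Proof.
have -> : walk_types = (finset.setX [set: {ffun 'I_n -> bool}]
    [set s : 'S_n.+1 | perm_on [set~ ord0] s])%SET.
  apply/setP => -[b s]; rewrite !inE /=; apply/eqP/idP => [s0|on].
    apply/fintype.subsetP => i; rewrite !inE.
    by apply: contra => /eqP ->; rewrite s0.
  by apply: (out_perm on); rewrite !inE eqxx.
rewrite cardsX cardsT card_ffun card_bool card_ord cardsE card_perm.
by rewrite cardsC1 card_ord.
Qed.

Lemma type_transl0 u : type_transl u ord0 = 0.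
Proof. by rewrite /type_transl big_pred0. Qed.

Lemma type_translS u c : type_transl u (up c) =
  type_transl u (low c) + (~~ u.1 c)%:Z - (u.2 (up c) < u.2 (low c))%N%:Z.
Proof.
by rewrite /type_transl sum_below_up addrA.
Qed.

Lemma low_up (c : 'I_n) : low c != up c.
Proof. by rewrite -(inj_eq val_inj) /= /bump; lia. Qed.

Lemma type_address u c : address (type_window u) (low c) (up c) = - (~~ u.1 c)%:Z.
Proof. by rewrite address_window type_translS; ring. Qed.

Lemma type_window_step u c :
  `|type_window u (up c) - type_window u (low c)| < h.
Proof.
have := window_sub u.2 (type_transl u) (low_up c).
by rewrite -/(type_window u) type_address; case: (u.1 c) => /=; lia.
Qed.

Lemma type_window0 u : u \in walk_types -> type_window u ord0 = 0.
Proof.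
by rewrite inE /type_window /window type_transl0 mulr0 subr0 => /eqP ->.
Qed.

Lemma type_window_surj (s : 'S_n.+1) (t : 'I_n.+1 -> int) : s ord0 = ord0 -> t ord0 = 0 ->
  (forall c : 'I_n, `|window s t (up c) - window s t (low c)| < h) ->
  exists2 u, u \in walk_types & type_window u = window s t.
Proof.
move=> s0 t0 st.
exists ([ffun c => address (window s t) (low c) (up c) == 0], s).
  by rewrite inE s0.
rewrite /type_window /=; congr (window s _).
pose u : walk_type := ([ffun c => address (window s t) (low c) (up c) == 0], s).
suff e i : type_transl u i - t i = type_transl u ord0 - t ord0.
  by apply/funext => i; apply/eqP; rewrite -subr_eq0 e type_transl0 t0.
apply: (@const_ord _ n (fun i => type_transl u i - t i)) => c.
pose a := address (window s t) (low c) (up c).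
have lt := st c; have /andP[l1 l2] := window_sub s t (low_up c); rewrite -/a in l1 l2.
(* A step shorter than [n+1] has address 0 or -1, so its sign determines the increment of [t]. *)
have l3 : h * a < h * 1 by lia.
have l4 : h * (-1) < h * (a + 1) by lia.
rewrite !ltr_pM2l // in l3 l4.
have A : a = t (low c) - t (up c) - (s (up c) < s (low c))%N%:Z := address_window s t _ _.
rewrite type_translS /= ffunE -/a.
have a01 : a = 0 \/ a = -1 by lia.
move: a01 A => [] -> /=;
  by move: (type_transl _ _) (t _) (t _) (nat_of_bool (s _ < s _)%N) => x y z q; lia.
Qed.

(** By [window_const] the windows differ by a constant, which is 0 at the starting point; the signs
    are then read off the increments of the translation. *)
Lemma type_window_inj u u' : (0 < n)%N -> u \in walk_types -> u' \in walk_types ->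
  (forall i j, i != j ->
     address (type_window u) i j = address (type_window u') i j) -> u = u'.
Proof.
move=> n0 U U' e.
have [|c ec] := @window_const n u.2 u'.2 (type_transl u) (type_transl u') n0.
  by move=> k; rewrite -/(type_window u) -/(type_window u') e // pos_neq.
have c0 : c = 0.
  by have := ec ord0; rewrite -/(type_window u) -/(type_window u') !type_window0 //; lia.
have [|es et] := @window_inj n u'.2 (type_transl u') u.2 (type_transl u).
  by move=> i; rewrite ec c0 addr0.
case: u u' es et {ec e U U' c0} => [b s] [b' s'] /= es et; subst s'.
congr (_, _); apply/ffunP => k.
have := congr1 (fun f => f (up k)) et; rewrite !type_translS et /=.
by case: (b k); case: (b' k) => //=; lia.
Qed.

End Types.

(** * The bijection between the weak interval and the types with pattern [p] *)

Lemma card_eq_finset (T : finType) (A : {set T}) : ([set` A] #= `I_#|A|)%card.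
Proof.
have -> : [set` A] = (fun i : 'I_#|A| => enum_val i) @` setT.
  apply/seteqP; split=> x /=; last by move=> [i _ <-]; exact: enum_valP.
  by move=> xA; exists (enum_rank_in xA x) => //; rewrite enum_rankK_in.
apply: card_eq_trans (inj_card_eq _) _; first by move=> i j _ _; exact: enum_val_inj.
by rewrite card_eq_sym; exact: card_II.
Qed.

Section Bijection.
Variables (R : realType) (n : nat) (p : 'S_n.+1).
Local Notation V := (hypV R n).
Local Notation h := (n.+1%:Z).

Lemma address_ge0 (s : 'S_n.+1) (t : 'I_n.+1 -> int) i j : i != j ->
  (0 <= address (window s t) i j) = (window s t i < window s t j).
Proof.
move=> ij; have /andP[l1 l2] := window_sub s t ij.
apply/idP/idP => [a0|lt].
  by rewrite -(ler_pM2l (isT : 0 < h)) mulr0 in a0; lia.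
have : h * 0 < h * (address (window s t) i j + 1) by lia.
by rewrite ltr_pM2l //; lia.
Qed.

Definition pattern_types : {set walk_type n} :=
  [set u in walk_types n | [forall i : 'I_n.+1, forall j : 'I_n.+1,
     (p i < p j)%N ==> (type_window u i < type_window u j)]]%SET.

(** The constant reconciles two normalizations: windows of group elements are balanced, windows of
    types start at 0. *)
Definition of_type (v : V -> V) (u : walk_type n) := exists s t,
  [/\ balanced t, represents v s t &
   exists c, forall i, type_window u i = window s t (p i) + c].

Lemma of_type_injl v v' u : of_type v u -> of_type v' u -> v = v'.
Proof.
move=> [s [t [b r [c e]]]] [s' [t' [b' r' [c' e']]]].
have [|es et] := @window_balanced_inj n s t s' t' (c - c') b b'.
  by move=> i; have := e ((p^-1)%g i); rewrite e' permKV; lia.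
by rewrite -es -et in r'; exact: represents_inj r r'.
Qed.

Hypothesis n_gt0 : (0 < n)%N.

Lemma of_type_injr v u u' : u \in walk_types n -> u' \in walk_types n ->
  of_type v u -> of_type v u' -> u = u'.
Proof.
move=> U U' [s [t [b r [c e]]]] [s' [t' [b' r' [c' e']]]].
have [es et] := represents_window_inj r r'; subst s' t'.
apply: type_window_inj => // i j _; rewrite /address !e !e'.
by congr (_ %/ _)%Z; ring.
Qed.

Lemma window_of_type (v : V -> V) s t : balanced t -> represents v s t ->
  (forall i j : 'I_n.+1, (i < j)%N -> 0 <= address (window s t) i j) ->
  (forall c : 'I_n, `|window s t (p (up c)) - window s t (p (low c))| < h) ->
  exists2 u, u \in pattern_types & of_type v u.
Proof.
move=> b r pos st; set y := window s t in pos st *.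
(* Reading [y] along [p] and translating keeps the entries pairwise incongruent, so a window
   results. *)
have [i j e|s1 [t1 e]] := @windowP n (fun i => y (p i) - y (p ord0)).
  apply: (@perm_inj _ p); apply: (@window_mod_inj n s t); apply/eqP.
  move/eqP: e; rewrite !eqz_mod_dvd -/y => /=.
  by congr (_ %| _)%Z; ring.
have e0 : window s1 t1 ord0 = 0 by rewrite -e subrr.
have [s10 t10] : s1 ord0 = ord0 /\ t1 ord0 = 0.
  have t10 : t1 ord0 = 0.
    move: e0; rewrite /window => e0; have := ltn_ord (s1 ord0) => lt.
    have l1 : h * t1 ord0 < h * 1 by lia.
    have l2 : h * (-1) < h * t1 ord0 by lia.
    by rewrite !ltr_pM2l // in l1 l2; lia.
  split=> //; apply: val_inj; move: e0; rewrite /window t10 mulr0 subr0.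
  by case.
have [c|u U eu] := type_window_surj s10 t10.
  by rewrite -e /=; have := st c; congr (_ < _); congr `|_|; ring.
exists u.
  rewrite inE U eu -e; apply/forallP => i; apply/forallP => j; apply/implyP => ij.
  by rewrite ltrD2r -address_ge0 ?pos // -(inj_eq val_inj) /= ltn_eqF.
exists s, t; split=> //; exists (- y (p ord0)) => i.
by rewrite eu -e.
Qed.

Lemma type_of_window u : u \in pattern_types -> exists2 v : V -> V, of_type v u &
  exists s t, [/\ balanced t, represents v s t,
  (forall i j : 'I_n.+1, (i < j)%N -> 0 <= address (window s t) i j) &
  (forall c : 'I_n, `|window s t (p (up c)) - window s t (p (low c))| < h)].
Proof.
rewrite inE => /andP[U /forallP pat].
(* The type window is read back along the inverse of [p], then shifted until it is balanced. *)
have [s [t [c [b e]]]] := window_shift_balanced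
  (p^-1 * u.2)%g (fun i => type_transl u ((p^-1)%g i)).
have {}e i : window s t i = type_window u ((p^-1)%g i) + c.
  by rewrite e /type_window /window permM.
have [l [r _]] := represents_word R n_gt0 s b.
exists (@word R n l).
  exists s, t; split=> //; exists (- c) => i.
  by rewrite e permK addrK.
exists s, t; split=> //.
  move=> i j ij; rewrite address_ge0; last by rewrite -(inj_eq val_inj) /= ltn_eqF.
  rewrite !e ltrD2r; have /forallP/(_ ((p^-1)%g j)) := pat ((p^-1)%g i).
  by rewrite !permKV ij.
move=> k; rewrite !e !permK; have := type_window_step u k.
by congr (_ < _); congr `|_|; ring.
Qed.

Lemma card_weak_interval1 (w : V -> V) : affine_weyl w ->
  has_address (w @` fundamental_alcove R n)
    (fun i j => (ideal_coef R (root_ideal p) i j)%:Z) ->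
  (weak_interval1 w #= `I_#|pattern_types|)%card.
Proof.
move=> aw addr_w.
have [s' [t' [b' r']]] := affine_weyl_represents aw.
have addr := address_of_alcove r' addr_w.
have pos' : between0 (window s' t') (window s' t').
  by move=> i j ij; rewrite lexx andbT addr.
have intP v : weak_interval1 w v <-> exists s t, [/\ balanced t, represents v s t,
  (forall i j : 'I_n.+1, (i < j)%N -> 0 <= address (window s t) i j) &
  (forall c : 'I_n, `|window s t (p (up c)) - window s t (p (low c))| < h)].
  apply: iff_trans (weak_interval1P n_gt0 v b' r' pos') _.
  split=> -[s [t]].
    move=> [b r bet]; exists s, t.
    have pos (i j : 'I_n.+1) (ij : (i < j)%N) := proj1 (andP (bet i j ij)).
    split=> //; apply/(ideal_coef_boundP R p pos) => i j ij.
    by rewrite -addr //; have /andP[] := bet i j ij.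
  move=> [b r pos st]; exists s, t; split=> // i j ij; rewrite pos //= addr //.
  exact: (ideal_coef_boundP R p pos).2.
have /choice[f fP] u : exists v : V -> V, u \in pattern_types ->
    of_type v u /\ weak_interval1 w v.
  case: (boolP (u \in pattern_types)) => [/type_of_window[v vu /intP int]|_].
    by exists v.
  by exists id.
have -> : weak_interval1 w = f @` [set` pattern_types].
  apply/seteqP; split=> v /=; last by move=> [u /fP[_ int] <-].
  move=> /intP[s [t [b r pos st]]].
  have [u U vu] := window_of_type b r pos st.
  by exists u => //; have [fu _] := fP u U; exact: of_type_injl fu vu.
apply: card_eq_trans (card_eq_finset pattern_types); apply: inj_card_eq.
move=> u u'; rewrite !inE => U U' e.
have [fu _] := fP u U; have [fu' _] := fP u' U'; rewrite -e in fu'.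
have sub x : x \in pattern_types -> x \in walk_types n by rewrite inE => /andP[].
exact: of_type_injr (sub u U) (sub u' U') fu fu'.
Qed.

End Bijection.

(** * Lower bounds by disjoint events, a limit of binomials, and ordinal patterns by comparison *)

Lemma measure_ge_card d (T : measurableType d) (R : realType)
    (P : probability T R) (I : finType) (A : {set I}) (F : I -> set T)
    (E : set T) (q : R) :
  measurable E -> (forall i, i \in A -> measurable (F i)) ->
  (forall i, i \in A -> F i `<=` E) -> (forall i, i \in A -> (q%:E <= P (F i))%E) ->
  (forall i j x, i \in A -> j \in A -> F i x -> F j x -> i = j) ->
  ((#|A|%:R * q)%:E <= P E)%E.
Proof.
move=> mE mF sub qF disj.
pose U (s : seq I) := \big[setU/set0]_(i <- s) F i.
suff H (s : seq I) : uniq s -> {subset s <= A} ->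
    [/\ measurable (U s), U s `<=` E & (((size s)%:R * q)%:E <= P (U s))%E].
  have sA : {subset enum A <= A} by move=> i; rewrite mem_enum.
  have [mU UE le] := H (enum A) (enum_uniq _) sA.
  rewrite cardE; apply: le_trans le _; apply: le_measure => //; exact/mem_set.
elim: s => [|i s IH] /=.
  by rewrite /U !big_nil mul0r measure0; split=> //; exact: sub0set.
move=> /andP[ns us] sA.
have iA : i \in A by apply: sA; rewrite inE eqxx.
have sA' : {subset s <= A} by move=> j js; apply: sA; rewrite inE js orbT.
have [mU UE le] := IH us sA'.
have dis : F i `&` U s = set0.
  apply/seteqP; split=> // x [Fi]; rewrite /U -bigcup_seq => -[j /= js Fj].
  by move: ns; rewrite (disj _ _ _ iA (sA' _ js) Fi Fj) js.
rewrite /U big_cons -/(U s); split.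
- by apply: measurableU => //; exact: mF.
- by rewrite subUset; split=> //; exact: sub.
- rewrite measureU //; last exact: mF.
  by rewrite -addn1 natrD mulrDl mul1r EFinD addeC leeD // qF.
Qed.

(** Each of the [n] factors of the falling factorial is at least [m - n]. *)
Lemma expn_sub_le_ffact m n : ((m - n) ^ n <= m ^_ n)%N.
Proof.
elim: n => [|n IH]; first by rewrite expn0 ffactn0.
rewrite expnSr ffactnSr leq_mul //; last by lia.
by apply: leq_trans IH; case: n => // n; rewrite leq_exp2r; lia.
Qed.

Lemma bernoulli_sub (R : realFieldType) (x : R) n : 0 <= x <= 1 ->
  1 - n%:R * x <= (1 - x) ^+ n.
Proof.
move=> /andP[x0 x1]; elim: n => [|n IH]; first by rewrite expr0 mul0r subr0.
have y0 : 0 <= 1 - x by lra.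
rewrite exprSr; apply: le_trans (ler_wpM2r y0 IH).
have : 0 <= n%:R * (x * x) :> R by rewrite !mulr_ge0.
rewrite -natr1; nra.
Qed.

(* Let [M] tend to infinity. *)
Lemma binomial_density (R : realType) (n D : nat) (c : R) :
  (forall M, (0 < M)%N -> 'C(M - D, n)%:R * ((2 * M%:R)^-1 ^+ n) <= c) ->
  (2 ^+ n * n`!%:R)^-1 <= c.
Proof.
move=> le; set Q := 2 ^+ n * n`!%:R.
have Q0 : 0 < Q by rewrite mulr_gt0 ?exprn_gt0 ?ltr0n ?fact_gt0.
rewrite -[Q^-1]mul1r ler_pdivrMr // leNgt; apply/negP => lt.
(* The falling factorial of [M - D] is at least [(M - K)^n], and [M] is so large that
   [n * K / M < 1 - c * Q], which contradicts Bernoulli's inequality. *)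
pose K := (D + n)%N.
pose M := (Num.bound ((n * K)%:R / (1 - c * Q)) + K).+1.
have M0 : (0 < M)%N by [].
have MR : 0 < M%:R :> R by rewrite ltr0n.
have le1 : (1 - K%:R / M%:R) ^+ n <= c * Q.
  have -> : 1 - K%:R / M%:R = (M - K)%:R / M%:R :> R.
    by rewrite natrB; [field; rewrite lt0r_neq0 | rewrite /M; lia].
  have : ((M - K) ^ n <= 'C(M - D, n) * n`!)%N.
    by rewrite bin_ffact subnDA; exact: expn_sub_le_ffact.
  rewrite -(ler_nat R) natrX natrM => le2.
  have := le M M0; rewrite exprVn exprMn ler_pdivrMr; last first.
    by rewrite mulr_gt0 // exprn_gt0.
  rewrite expr_div_n ler_pdivrMr ?exprn_gt0 // => le3.
  apply: le_trans le2 _.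
  apply: (le_trans (ler_wpM2r _ le3)); first by rewrite ler0n.
  by rewrite /Q le_eqVlt; apply/orP; left; apply/eqP; ring.
have x01 : 0 <= (K%:R / M%:R : R) <= 1.
  rewrite divr_ge0 //= ler_pdivrMr // mul1r ler_nat /M; lia.
have := le_trans (bernoulli_sub n x01) le1.
rewrite lerBlDr -lerBlDl [n%:R * _]mulrA -natrM ler_pdivlMr // => le4.
have c1 : 0 < 1 - c * Q by lra.
have := archi_boundP (divr_ge0 (ler0n R (n * K)) (ltW c1)).
rewrite ltr_pdivrMr // mulrC => lt5.
have : (Num.bound ((n * K)%:R / (1 - c * Q)))%:R <= M%:R :> R by rewrite ler_nat /M; lia.
by move=> /(ler_wpM2l (ltW c1)) le6; have := lt_le_trans lt5 (le_trans le6 le4); rewrite ltxx.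
Qed.

Lemma has_ordinal_patternP (R : realType) n (z : 'I_n.+1 -> R) (p : 'S_n.+1) :
  has_ordinal_pattern z p <-> (forall i j, (p i < p j)%N -> z i < z j).
Proof.
split=> [[zinj rk] i j ij|lt].
  rewrite ltNge; apply/negP => zji.
  have : (#|[set l | (z l <= z j)%R]%SET| <= #|[set l | (z l <= z i)%R]%SET|)%N.
    apply/subset_leq_card/fintype.subsetP => l; rewrite !inE => lj.
    exact: le_trans lj zji.
  by rewrite -!rk ltnS leqNgt ij.
have zle i j : (z i <= z j) = (p i <= p j)%N.
  apply/idP/idP; first by apply: contraTT; rewrite -ltnNge -ltNge => /lt.
  by rewrite leq_eqVlt => /orP[/eqP/val_inj/perm_inj ->//|/lt/ltW].
split=> [i j e|i].
  by apply: (@perm_inj _ p); apply: val_inj; apply/eqP; rewrite eqn_leq -!zle e lexx.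
have pi := ltn_ord (p i).
have -> : [set j | (z j <= z i)%R]%SET =
    [set (p^-1)%g (widen_ord pi x) | x : 'I_(p i).+1]%SET.
  apply/setP => j; rewrite inE zle; apply/idP/imsetP => [le|[x _ ->]].
    exists (Ordinal (le : (p j < (p i).+1)%N)) => //.
    rewrite (_ : widen_ord _ _ = p j) ?permK //; exact: val_inj.
  by rewrite permKV /= -ltnS ltn_ord.
rewrite card_imset ?card_ord // => x y /perm_inj /(congr1 val) /= e.
exact: val_inj.
Qed.

(** * Probabilities of the types, by counting grid cells *)

Section Walk.
Variables (R : realType) (n : nat) (d : measure_display) (T : measurableType d).
Variables (P : probability T R) (X : 'I_n -> {RV P >-> R}).
Hypothesis X_indep : mutually_independent X.
Hypothesis X_density : forall i, has_density (X i) (uniform_density R).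
Local Notation h := (n.+1%:Z).

Lemma prob_interval i (a b : R) : -1 <= a -> a < b -> b <= 1 ->
  P (X i @^-1` `]a, b[) = ((b - a) / 2)%:E.
Proof.
move=> a1 ab b1.
rewrite -[LHS]/(distribution P (X i) `]a, b[) X_density; last exact: measurable_itv.
rewrite (eq_integral (cst (2^-1 : R)%:E)); last first.
  move=> x; rewrite inE /= in_itv /= => /andP[ax xb].
  rewrite /uniform_density indicE mem_set ?mulr1 //= in_itv /=.
  by apply/andP; split; lra.
rewrite integral_cst; last exact: measurable_itv.
by rewrite /= lebesgue_measure_itv /= lte_fin ab -EFinD -EFinM mulrC.
Qed.

Definition box (M : nat) (c : 'I_n -> int) : set T :=
  [set t | forall i, (c i)%:~R / M%:R < X i t < ((c i)%:~R + 1) / M%:R].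

Lemma boxE M c : box M c = \bigcap_(i in [set` [set: 'I_n]%SET])
  (X i @^-1` `](c i)%:~R / M%:R, ((c i)%:~R + 1) / M%:R[).
Proof.
apply/seteqP; split=> t H i; first by move=> _; rewrite /= in_itv; exact: H.
have iT : [set` [set: 'I_n]%SET] i by rewrite /= inE.
by have := H i iT; rewrite /= in_itv.
Qed.

Lemma measurable_box M c : measurable (box M c).
Proof.
rewrite boxE; apply: fin_bigcap_measurable => [|i _]; first exact: finite_finset.
by rewrite -[X in measurable X]setTI; apply: measurable_funP => //; exact: measurable_itv.
Qed.

(** The bounds on [c] keep the cell inside the cube where the density is constant. *)
Lemma prob_box M c : (0 < M)%N -> (forall i, - M%:Z <= c i < M%:Z) ->
  P (box M c) = ((2 * M%:R)^-1 ^+ n)%:E.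
Proof.
move=> M0 cM; rewrite boxE (X_indep [set: 'I_n]%SET
  (B := fun i => `](c i)%:~R / M%:R, ((c i)%:~R + 1) / M%:R[%classic)); last first.
  by move=> i; exact: measurable_itv.
have MR : 0 < M%:R :> R by rewrite ltr0n.
rewrite (eq_bigr (fun=> ((2 * M%:R)^-1)%:E)).
  by rewrite prodEFin prodr_const cardsT card_ord.
move=> i _; have /andP[c1 c2] := cM i.
have c1' : - M%:R <= (c i)%:~R :> R by rewrite [M%:R]pmulrn -rmorphN ler_int.
have c2' : (c i)%:~R + 1 <= M%:R :> R.
  by rewrite -[1]/(1%:~R) -rmorphD [M%:R]pmulrn ler_int; lia.
rewrite prob_interval.
- by congr (_%:E); field; rewrite lt0r_neq0.
- by rewrite ler_pdivlMr // mulN1r.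
- by rewrite ltr_pM2r ?invr_gt0 // ltrDl.
- by rewrite ler_pdivrMr // mul1r.
Qed.

(** At most [n] steps are summed, each rounded down by at most 1. *)
Lemma walk_bounds M c t (i : 'I_n.+1) : (0 < M)%N -> box M c t ->
  (\sum_(j < n | (j < i)%N) c j)%:~R <= M%:R * walk X t i <=
  (\sum_(j < n | (j < i)%N) c j)%:~R + n%:R.
Proof.
move=> M0 bt; have MR : 0 < M%:R :> R by rewrite ltr0n.
have le j : (c j)%:~R <= M%:R * X j t <= (c j)%:~R + 1.
  have /andP[/ltW l1 /ltW l2] := bt j.
  by rewrite ler_pdivrMr // mulrC in l1; rewrite ler_pdivlMr // mulrC in l2; rewrite l1.
rewrite /walk mulr_sumr rmorph_sum /=; apply/andP; split.
  by apply: ler_sum => j _; have /andP[] := le j.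
have -> : n%:R = \sum_(j < n) 1 :> R by rewrite sumr_const card_ord.
apply: (@le_trans _ _ (\sum_(j < n | (j < i)%N) ((c j)%:~R + 1))).
  by apply: ler_sum => j _; have /andP[] := le j.
rewrite big_split /= lerD2l [leRHS](bigID (fun j : 'I_n => (j < i)%N)) /= lerDl.
exact: sumr_ge0.
Qed.

Lemma box_inj M c c' t : (0 < M)%N -> box M c t -> box M c' t -> c =1 c'.
Proof.
move=> M0 bt bt' i; have MR : 0 < M%:R :> R by rewrite ltr0n.
have /andP[l1 l2] := bt i; have /andP[l3 l4] := bt' i.
have := lt_trans l1 l4; have := lt_trans l3 l2.
rewrite !ltr_pM2r ?invr_gt0 // -[1]/(1%:~R) -!rmorphD !ltr_int; lia.
Qed.

(** The integer parts of all differences are prescribed by [u]: upper bounds over ordered pairs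
    suffice, since by [address_opp] the swapped pair gives the lower bound. *)
Definition type_event (u : walk_type n) : set T :=
  [set t | forall i j, i != j ->
     walk X t i - walk X t j < (address (type_window u) j i + 1)%:~R].

Lemma measurable_walk i : measurable_fun setT (walk X ^~ i).
Proof.
rewrite /walk; under eq_fun do rewrite big_mkcond.
apply: measurable_sum => j; case: (j < i)%N; first exact: measurable_funP.
exact: measurable_cst.
Qed.

Lemma measurable_walk_lt i j (a : R) :
  measurable [set t | walk X t i - walk X t j < a].
Proof.
have mB : measurable_fun setT (fun t => walk X t i - walk X t j).
  by apply: measurable_realfun.measurable_funB; exact: measurable_walk.
have := mB measurableT `]-oo, a[%classic (measurable_itv _); rewrite setTI.
by congr measurable; apply/seteqP; split=> t /=; rewrite in_itv.
Qed.

Lemma measurable_type_event u : measurable (type_event u).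
Proof.
have -> : type_event u = \bigcap_(ij in [set ij : 'I_n.+1 * 'I_n.+1 | ij.1 != ij.2])
    [set t | walk X t ij.1 - walk X t ij.2 <
      (address (type_window u) ij.2 ij.1 + 1)%:~R].
  apply/seteqP; split=> t H; first by move=> [i j] /=; exact: H.
  by move=> i j ij; exact: (H (i, j)).
apply: fin_bigcap_measurable => [|ij _]; first exact: finite_finset.
exact: measurable_walk_lt.
Qed.

Section Lattice.
Variables (M m : nat) (u : walk_type n).
Hypothesis Mm : (m + n.+1 ^ 2 <= M)%N.
Implicit Type e : n.-tuple 'I_m.

(* The gaps of at least [n+1] absorb the [n] rounding errors of size at most 1. *)
Definition place e (r : nat) : int :=
  if r is r'.+1 then (nth 0%N (map val e) r' + n.+1 * r)%N%:Z else 0.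

(** This is the walk scaled by [M]: the fractional part has rank [u.2 i], and the integer part is
    [- type_transl u i]. *)
Definition lattice_point e (i : 'I_n.+1) : int :=
  place e (u.2 i) - M%:Z * type_transl u i.

Definition lattice_step e (c : 'I_n) : int :=
  lattice_point e (up c) - lattice_point e (low c).

Lemma nth_lt e r : (r < n)%N -> (nth 0%N (map val e) r < m)%N.
Proof.
by move=> rn; rewrite (nth_map (tnth e (Ordinal rn))) ?size_tuple ?ltn_ord.
Qed.

Lemma place_ge0 e r : 0 <= place e r.
Proof. by case: r. Qed.

(** This is the gap that wraps around from the highest place to [M]; the [n] inner gaps and this one
    together use [(n+1)^2]. *)
Lemma place_le e r : (r <= n)%N -> place e r + h <= M%:Z.
Proof.
case: r => [_|r rn]; rewrite /place.
  by rewrite add0r lez_nat; apply: leq_trans Mm; rewrite expnS; nia.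
have := nth_lt e rn => lt; rewrite -PoszD lez_nat.
apply: leq_trans Mm; rewrite -addnA; apply: leq_add; first exact: ltnW.
by rewrite -mulnSr expnS expn1 leq_mul2l; lia.
Qed.

Lemma place_gap e r r' : sorted ltn (map val e) -> (r < r')%N -> (r' <= n)%N ->
  place e r + h <= place e r'.
Proof.
move=> se; case: r' => // r' rr' r'n; rewrite /place.
case: r rr' => [_|r rr']; first by rewrite add0r lez_nat; nia.
have : (nth 0%N (map val e) r < nth 0%N (map val e) r')%N.
  apply: (sorted_ltn_nth ltn_trans) => //; rewrite inE size_map size_tuple; lia.
rewrite -PoszD lez_nat; nia.
Qed.

(** If [u.2 i < u.2 j] the room comes from the gap between the two places, otherwise from the gap
    that wraps around to [M]. *)
Lemma lattice_gap e i j : sorted ltn (map val e) -> i != j ->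
  lattice_point e i - lattice_point e j + h <=
  M%:Z * (address (type_window u) j i + 1).
Proof.
move=> se ij; rewrite address_window /lattice_point.
have := @perm_neq n u.2 i j ij.
have := ltn_ord (u.2 i); have := ltn_ord (u.2 j); rewrite !ltnS => hj hi ne.
have [lt|ge] := ltnP (u.2 i) (u.2 j).
  by have := place_gap se lt hj => /=; rewrite subrK mulrBr; lia.
have := place_le e hi; have := place_ge0 e (u.2 j).
by rewrite subr0 mulrDr mulrBr mulr1; lia.
Qed.

Lemma lattice_step_bound e : sorted ltn (map val e) ->
  forall c, - M%:Z <= lattice_step e c < M%:Z.
Proof.
move=> se c; have lu := low_up c; have ul : up c != low c by rewrite eq_sym.
have := lattice_gap se lu; have := lattice_gap se ul.
rewrite (@address_opp _ u.2 (type_transl u) _ _ lu) -/(type_window u) type_address.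
have M0 : 0 <= M%:Z by [].
by rewrite /lattice_step; case: (u.1 c) => /=; rewrite ?oppr0 ?subr0 ?opprK ?subrr; lia.
Qed.

Hypothesis U : u \in walk_types n.

Lemma lattice_pointE e (i : 'I_n.+1) :
  \sum_(j < n | (j < i)%N) lattice_step e j = lattice_point e i.
Proof.
suff : \sum_(j < n | (j < i)%N) lattice_step e j - lattice_point e i = 0.
  by move/eqP; rewrite subr_eq0 => /eqP.
rewrite (@const_ord _ n (fun i : 'I_n.+1 =>
  \sum_(j < n | (j < i)%N) lattice_step e j - lattice_point e i)).
  move: U; rewrite inE => /eqP u0.
  by rewrite big_pred0 // /lattice_point type_transl0 u0 /= mulr0 !subr0.
by move=> c; rewrite sum_below_up /lattice_step; ring.
Qed.

(** Scaled by [M], the walk is off the lattice points by at most [n], and [lattice_gap] leaves room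
    [n+1]. *)
Lemma box_type_event e : sorted ltn (map val e) ->
  box M (lattice_step e) `<=` type_event u.
Proof.
move=> se t bt i j ij.
have M0 : (0 < M)%N by apply: leq_trans Mm; rewrite addn_gt0 expn_gt0 orbT.
have MR : 0 < M%:R :> R by rewrite ltr0n.
have /andP[_ l1] := walk_bounds i M0 bt; have /andP[l2 _] := walk_bounds j M0 bt.
rewrite !lattice_pointE in l1 l2.
rewrite -(ltr_pM2l MR) mulrBr.
have := lattice_gap se ij; rewrite -(ler_int R) rmorphD rmorphB rmorphM /=.
rewrite -[M%:~R]pmulrn -[h%:~R]pmulrn -natr1; lra.
Qed.

(** Partial sums recover the lattice points, and the point of rank [r+1] recovers the entry [r] of
    the tuple. *)
Lemma lattice_step_inj e e' : lattice_step e =1 lattice_step e' -> e = e'.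
Proof.
move=> eq; apply: eq_from_tnth => r.
have eqp i : lattice_point e i = lattice_point e' i.
  by rewrite -!lattice_pointE; apply: eq_bigr => j _; rewrite eq.
have := eqp ((u.2^-1)%g (up r)); rewrite /lattice_point permKV => /addIr.
rewrite /place /= => -[] /addIn eqn.
have {}eqn : nth 0%N (map val e) r = nth 0%N (map val e') r by exact: eqn.
have x0 : 'I_m := tnth e r.
rewrite !(nth_map x0) ?size_tuple ?ltn_ord // in eqn.
by rewrite !(tnth_nth x0); exact: val_inj.
Qed.

End Lattice.

Hypothesis n_gt0 : (0 < n)%N.

Lemma type_event_inj u u' t : u \in walk_types n -> u' \in walk_types n ->
  type_event u t -> type_event u' t -> u = u'.
Proof.
move=> U U' E E'; apply: type_window_inj => // i j ij.
have ji : j != i by rewrite eq_sym.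
have bd v : type_event v t -> (address (type_window v) i j)%:~R <
    walk X t j - walk X t i < (address (type_window v) i j + 1)%:~R.
  move=> Ev; rewrite (Ev j i ji) andbT.
  have e : address (type_window v) j i + 1 = - address (type_window v) i j.
    by rewrite /type_window (@address_opp _ _ _ i j) //; ring.
  by have := Ev i j ij; rewrite e rmorphN /=; lra.
have /andP[l1 l2] := bd _ E; have /andP[l3 l4] := bd _ E'.
have := lt_trans l1 l4; have := lt_trans l3 l2; rewrite !ltr_int; lia.
Qed.

(** Each of the ['C(M - (n+1)^2, n)] increasing tuples gives its own cell inside the event;
    [binomial_density] then lets the grid become finer. *)
Lemma type_event_ge u : u \in walk_types n ->
  (((2 ^+ n * n`!%:R)^-1)%:E <= P (type_event u))%E.
Proof.
move=> U; have mE := measurable_type_event u.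
rewrite -(fineK (fin_num_measure P _ mE)) lee_fin.
apply: (@binomial_density R n (n.+1 ^ 2)) => M M0.
rewrite -lee_fin (fineK (fin_num_measure P _ mE)).
(* For [M < (n+1)^2] the truncated difference is 0, and the binomial coefficient vanishes because
   [n > 0]. *)
have [le|lt] := leqP (n.+1 ^ 2) M; last first.
  have -> : (M - n.+1 ^ 2 = 0)%N by lia.
  by rewrite bin0n; case: n n_gt0 => // n' _; rewrite mul0r measure_ge0.
set m := (M - _)%N; have Mm : (m + n.+1 ^ 2 <= M)%N by rewrite /m subnK.
rewrite -card_ltn_sorted_tuples.
apply: (@measure_ge_card _ _ _ P _ _ (fun e => box M (lattice_step M u e))) => //.
- by move=> e _; exact: measurable_box.
- by move=> e; rewrite inE => se; exact: box_type_event.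
- move=> e; rewrite inE => se; rewrite prob_box //.
  exact: lattice_step_bound Mm _ se.
- by move=> e e' t _ _ b b'; apply: lattice_step_inj (box_inj M0 b b').
Qed.



End Walk.

(** * The ordinal pattern as a function of the type *)

Section Pattern.
Variables (R : realType) (n : nat) (d : measure_display) (T : measurableType d).
Variables (P : probability T R) (X : 'I_n -> {RV P >-> R}) (p : 'S_n.+1).

Lemma type_event_lt u t i j : type_event X u t -> i != j ->
  (walk X t i < walk X t j) = (type_window u i < type_window u j).
Proof.
move=> E; have lt k l : k != l -> type_window u k < type_window u l ->
    walk X t k < walk X t l.
  move=> kl; rewrite -address_ge0 // => a0; have := E _ _ kl.
  have -> : address (type_window u) l k + 1 = - address (type_window u) k l.
    by rewrite /type_window (@address_opp _ _ _ k l) //; ring.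
  by rewrite rmorphN /=; rewrite -(ler0z R) in a0; lra.
move=> ij; apply/idP/idP; last exact: lt.
apply: contraTT; rewrite -!leNgt le_eqVlt => /orP[/eqP e|].
  by move: ij; rewrite (@window_mod_inj n u.2 (type_transl u) i j) ?eqxx // -/(type_window u) e.
by move=> /(lt _ _ _)/ltW; apply; rewrite eq_sym.
Qed.

Lemma type_event_pattern u t : u \in walk_types n -> type_event X u t ->
  has_ordinal_pattern (walk X t) p <-> u \in pattern_types p.
Proof.
move=> U E; rewrite inE U /=; apply: iff_trans (has_ordinal_patternP _ _) _.
have ne i j : (p i < p j)%N -> i != j by apply: contraTneq => ->; rewrite ltnn.
split=> [lt|/forallP lt i j ij].
  apply/forallP => i; apply/forallP => j; apply/implyP => ij.
  by rewrite -(type_event_lt E) ?ne // lt.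
by rewrite (type_event_lt E) ?ne //; have /forallP/(_ j)/implyP -> := lt i.
Qed.

Lemma measurable_pattern : measurable [set t | has_ordinal_pattern (walk X t) p].
Proof.
have -> : [set t | has_ordinal_pattern (walk X t) p] =
    \bigcap_(ij in [set ij : 'I_n.+1 * 'I_n.+1 | (p ij.1 < p ij.2)%N])
      [set t | walk X t ij.1 - walk X t ij.2 < 0].
  apply/seteqP; split=> t /=; rewrite has_ordinal_patternP => H.
    by move=> [i j] /= /H; rewrite subr_lt0.
  by move=> i j ij; rewrite -subr_lt0; exact: (H (i, j)).
apply: fin_bigcap_measurable => [|ij _]; first exact: finite_finset.
exact: measurable_walk_lt.
Qed.

End Pattern.

Theorem theorem5p29 (R : realType) (n : nat) (n_ge1 : (1 <= n)%N)
    (d : measure_display) (T : measurableType d) (P : probability T R)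
    (X : 'I_n -> {RV P >-> R})
    (X_indep : mutually_independent X)
    (X_density : forall i, has_density (X i) (uniform_density R))
    (p : 'S_n.+1) (w : hypV R n -> hypV R n)
    (w_affine : affine_weyl w)
    (w_address : has_address (w @` fundamental_alcove R n)
       (fun i j => (ideal_coef R (root_ideal p) i j)%:Z)) :
  exists2 m : nat, (weak_interval1 w #= `I_m)%card &
    P [set t | has_ordinal_pattern (walk X t) p] =
      (m%:R / (2 ^+ n * (n`!)%:R))%:E.
Proof.
exists #|pattern_types p|; first exact: card_weak_interval1.
set S := [set t | _]; have mS : measurable S := measurable_pattern X p.
set q := 2 ^+ n * n`!%:R.
have q0 : q != 0 :> R by rewrite mulf_neq0 ?expf_neq0 // pnatr_eq0 -lt0n fact_gt0.
have subw u : u \in pattern_types p -> u \in walk_types n by rewrite inE => /andP[].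
have inj u u' t : u \in walk_types n -> u' \in walk_types n ->
    type_event X u t -> type_event X u' t -> u = u'.
  by move=> *; apply: type_event_inj; eauto.
have ge u : u \in walk_types n -> (q^-1%:E <= P (type_event X u))%E.
  by move=> U; exact: type_event_ge.
have low : ((#|pattern_types p|%:R * q^-1)%:E <= P S)%E.
  apply: (@measure_ge_card _ _ _ P _ _ (type_event X)) => //.
  - by move=> u _; exact: measurable_type_event.
  - by move=> u A t E; apply/(type_event_pattern p (subw u A) E).
  - by move=> u /subw; exact: ge.
  - by move=> u u' t /subw U /subw U'; exact: inj.
(* The remaining types bound the probability of the complement from below. The two lower bounds add
   up to 1, so both are equalities. *)
pose B := (walk_types n :\: pattern_types p)%SET.
have BP u : u \in B -> u \in walk_types n /\ u \notin pattern_types p.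
  by rewrite inE => /andP[].
have upp : ((#|B|%:R * q^-1)%:E <= P (~` S))%E.
  apply: (@measure_ge_card _ _ _ P _ _ (type_event X)) => //.
  - exact: measurableC.
  - by move=> u _; exact: measurable_type_event.
  - by move=> u /BP[U A] t E /(type_event_pattern p U E); exact/negP.
  - by move=> u /BP[U _]; exact: ge.
  - by move=> u u' t /BP[U _] /BP[U' _]; exact: inj.
have cardB : (#|pattern_types p| + #|B| = 2 ^ n * n`!)%N.
  rewrite -card_walk_types -(cardsID (pattern_types p) (walk_types n)).
  congr (_ + _)%N; apply: eq_card => u; rewrite [RHS]inE.
  by apply/idP/andP => [A|[]//]; split; first exact: subw.
rewrite probability_setC // -(fineK (fin_num_measure P _ mS)) -EFinB !lee_fin in low upp *.
congr (_%:E); apply/eqP; rewrite eq_le low andbT.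
have : #|pattern_types p|%:R / q + #|B|%:R / q = 1.
  by rewrite -mulrDl -natrD cardB natrM natrX divff.
by lra.
Qed.
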